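(* Let $r\ge 2$ be fixed. There is a number $d_0=d_0(r)$ such that the following holds. Let $p=p(n)$ and let $G\in\mathcal{G}(n,r,p)$, and put $d=pn^{r-1}$ with $d\ge d_0$. Then $G$ almost surely (that is, with probability tending to $1$ as $n\to\infty$) has both properties $I(r,n,d)$ and $D(r,n,d)$.
   Context: $\mathcal{G}(n,r,p)$ is the random $r$-partite $r$-uniform hypergraph on vertex set $V=V_1\cup\cdots\cup V_r$ (disjoint classes, each of size $n$) in which each of the $n^r$ possible edges (sets containing exactly one vertex from each $V_i$) is present independently with probability $p$. For $X\subseteq V$ write $X_i=X\cap V_i$ and $i_X=\min\{i:|X_i|=\max_j|X_j|\}$. A set $X$ is independent if it contains no edge of $G$; $X$ is $k$-degenerate if for every nonempty $Y\subseteq X$ the induced subhypergraph $G[Y]$ has a vertex of degree at most $k$. For real $d$ with $1\le d\le n^{r-1}$: $G$ has property $I(r,n,d)$ if every independent set $X$ satisfies $\prod_{i\ne i_X}|X_i|<\frac{n^{r-1}}{d}\log^2 d$; $G$ has property $D(r,n,d)$ if every set $X$ with $\prod_{i\ne i_X}|X_i|<\frac{n^{r-1}}{d}$ is $(4\log d/\log\log d)$-degenerate. Here $\log$ is the natural logarithm. *)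

(* Defs.v *)
From HB Require Import structures.
From mathcomp Require Import all_boot all_order all_algebra.
From mathcomp Require Import all_classical all_reals all_analysis.

Set Implicit Arguments.
Unset Strict Implicit.
Unset Printing Implicit Defensive.

Import Order.TTheory GRing.Theory Num.Theory.
Import numFieldNormedType.Exports.

Local Open Scope ring_scope.

Section Hypergraphs.
Variables r n : nat.

(* The vertex (i, j) is the j-th vertex of the class V_i. *)
Definition vertex := ('I_r * 'I_n)%type.

Definition part (X : {set vertex}) (i : 'I_r) : {set vertex} :=
  [set v in X | v.1 == i].

Definition edges : {set {set vertex}} :=
  [set e : {set vertex} | [forall i : 'I_r, #|part e i| == 1%N]].

(* A hypergraph is identified with its set of edges. *)
Definition hypergraph := {set {set vertex}}.

Definition subhypergraph (G : hypergraph) (Y : {set vertex}) : hypergraph :=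
  [set e in G | e \subset Y].

Definition degree (G : hypergraph) (v : vertex) : nat :=
  #|[set e in G | v \in e]|.

Definition independent (G : hypergraph) (X : {set vertex}) : bool :=
  [forall e in G, ~~ (e \subset X)].

(* enum 'I_r is increasing, so find returns the least index i (counted from 0)
   for which |X_i| is maximal; it is smaller than r as soon as 0 < r. *)
Definition imax (X : {set vertex}) : nat :=
  find (fun i : 'I_r => #|part X i| == (\max_(j < r) #|part X j|)%N) (enum 'I_r).

Definition prod_others (X : {set vertex}) : nat :=
  (\prod_(i < r | (i : nat) != imax X) #|part X i|)%N.

Section Real.
Variable R : realType.

Definition degenerate (k : R) (G : hypergraph) (X : {set vertex}) : bool :=
  [forall Y : {set vertex}, (Y \subset X) && (Y != finset.set0) ==>
    [exists v in Y, (degree (subhypergraph G Y) v)%:R <= k]].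

Definition propI (d : R) (G : hypergraph) : bool :=
  [forall X : {set vertex}, independent G X ==>
    ((prod_others X)%:R < n%:R ^+ r.-1 / d * ln d ^+ 2)].

Definition propD (d : R) (G : hypergraph) : bool :=
  [forall X : {set vertex}, ((prod_others X)%:R < n%:R ^+ r.-1 / d) ==>
    degenerate (4 * ln d / ln (ln d)) G X].

Definition weight (p : R) (G : hypergraph) : R :=
  \prod_(e in edges) (if e \in G then p else 1 - p).

(* Probability of the event A in the model where each element of edges is
   present independently with probability p. *)
Definition Pr (p : R) (A : pred hypergraph) : R :=
  \sum_(G : hypergraph | (G \subset edges) && A G) weight p G.

End Real.
End Hypergraphs.

(* Main.v *)
(** A union bound over all vertex sets [X], grouped by the density [u = s / n] of the
    largest part.  There are at most [(e / u)^(r s)] sets of given [s], and for each of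
    them the bad event has probability at most [(b (u / e)^r)^s] with
    [b <= min(1 / d, u)]; since [b^s <= 2^-(s-1) s / n], the total is at most [4 / n].

    For [I], independence has probability [(1 - p)^(s Q)], where [Q] is the product of
    the other part sizes and [p Q >= log^2 d].  For [D], a set that is not
    [k]-degenerate contains [Y] with minimum degree at least [k' > k], so [Y] spans at
    least [s k'] edges, counted from its largest part; with [y = p Q < 1] an
    exponential moment gives probability at most [(e y / k')^(s k')].  Since
    [y <= d u^(r-1)], the count contributes at most [e^r (d / y)^2] to the base, and
    [k' (log k' - 1) >= (7/2) log d] wins. *)

Require Import Defs.
From HB Require Import structures.
From mathcomp Require Import all_boot all_order all_algebra.
From mathcomp Require Import all_classical all_reals all_analysis.
From mathcomp Require Import ring lra.

Set Implicit Arguments.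
Unset Strict Implicit.
Unset Printing Implicit Defensive.

Import Order.TTheory GRing.Theory Num.Theory.
Import numFieldNormedType.Exports.

Local Open Scope ring_scope.

(** * Part sizes of vertex sets and numbers of edges inside them *)

Section Counting.
Variables r n : nat.
Implicit Types (X Y : {set vertex r n}) (G : hypergraph r n).

Definition max_part X : nat := (\max_(j < r) #|part X j|)%N.

Lemma max_part_le X : (max_part X <= n)%N.
Proof.
apply/bigmax_leqP => j _; rewrite -[leqRHS]card_ord.
rewrite -(card_in_imset (f := snd) (D := part X j)) ?max_card //.
move=> [a b] [c d]; rewrite !inE /= => /andP[_ /eqP->] /andP[_ /eqP->] ->.
by [].
Qed.

Lemma part_le_max X i : (#|part X i| <= max_part X)%N.
Proof. exact: leq_bigmax. Qed.

Lemma card_le_max_part X : (#|X| <= r * max_part X)%N.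
Proof.
rewrite -sum1_card (partition_big fst predT) //=.
rewrite -[X in (X * _)%N]card_ord -sum_nat_const leq_sum // => i _.
rewrite (leq_trans _ (part_le_max X i)) // -sum1_card eq_leq //.
by apply: eq_bigl => v; rewrite inE.
Qed.

(** Trades the natural number returned by [find] for an ordinal, so that a largest part can be split
    off products. *)
Lemma imaxP X : (0 < r)%N -> exists2 i0 : 'I_r, #|part X i0| = max_part X &
  prod_others X = (\prod_(i < r | i != i0) #|part X i|)%N.
Proof.
move=> r_gt0; set a := fun i : 'I_r => #|part X i| == max_part X.
have amax : has a (enum 'I_r).
  have [|i iE] := @bigop.eq_bigmax _ (fun j => #|part X j|); first by rewrite card_ord.
  by apply/hasP; exists i; rewrite ?mem_enum // /a /max_part iE.
have fr : (find a (enum 'I_r) < r)%N by rewrite -[ltnRHS]size_enum_ord -has_find.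
exists (nth (Ordinal r_gt0) (enum 'I_r) (find a (enum 'I_r))).
  by apply/eqP/(nth_find (Ordinal r_gt0) amax).
rewrite /prod_others; apply: eq_bigl => i.
by rewrite -val_eqE /= nth_enum_ord.
Qed.

Lemma prod_partsE X : (0 < r)%N ->
  (\prod_(i < r) #|part X i| = max_part X * prod_others X)%N.
Proof. by move=> /(imaxP X)[i0 <- ->]; rewrite (bigD1 i0). Qed.

Lemma prod_others_le X : (0 < r)%N -> (prod_others X <= max_part X ^ r.-1)%N.
Proof.
move=> /(imaxP X)[i0 _ ->].
rewrite -[X in (_ ^ X.-1)%N]card_ord -(cardC1 i0) -prod_nat_const.
by apply: leq_prod => i _; exact: part_le_max.
Qed.

(** Multiplying by [max_part X] turns the left side into the full product, where the part at [i0] is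
    at most the maximum. Cancelling needs a positive maximum; otherwise both sides are
    [0 ^ r.-1]. *)
Lemma prod_others_le_without X (i0 : 'I_r) :
  (prod_others X <= \prod_(i < r | i != i0) #|part X i|)%N.
Proof.
have r_gt0 : (0 < r)%N by exact: leq_ltn_trans (ltn_ord i0).
have [] := posnP (max_part X) => [m0|m_gt0].
  have [j0 _ ->] := imaxP X r_gt0.
  have p0 i : #|part X i| = 0%N by apply/eqP; rewrite -leqn0 -m0 part_le_max.
  under eq_bigr do rewrite p0.
  by under [leqRHS]eq_bigr do rewrite p0; rewrite !prod_nat_const !cardC1.
rewrite -(leq_pmul2l m_gt0) -prod_partsE // (bigD1 i0) //= leq_mul2r.
by rewrite part_le_max orbT.
Qed.

(** The largest parts of [X] and [Y] may lie in different classes, so the product for [Y] that omits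
    the class chosen by [X] serves as intermediary. *)
Lemma prod_others_mono X Y : (0 < r)%N -> Y \subset X ->
  (prod_others Y <= prod_others X)%N.
Proof.
move=> /(imaxP X)[i0 _ ->] YX.
apply: leq_trans (prod_others_le_without Y i0) _.
apply: leq_prod => i _; apply: subset_leq_card; apply/fintype.subsetP => v.
by rewrite !inE => /andP[/(fintype.subsetP YX)-> ->].
Qed.

(** Edges are exactly the graphs of choice functions, so counting edges inside a set becomes
    counting a [family]. *)
Definition graph_edge (f : {ffun 'I_r -> 'I_n}) : {set vertex r n} :=
  [set v | v.2 == f v.1].

Lemma graph_edge_inj : injective graph_edge.
Proof.
move=> f g fg; apply/ffunP => i; apply/eqP.
by have /setP/(_ (i, f i)) := fg; rewrite !inE /= eqxx => <-.
Qed.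

Lemma graph_edgeP (e : {set vertex r n}) :
  reflect (exists f, e = graph_edge f) (e \in edges r n).
Proof.
rewrite inE; apply: (iffP forallP) => [e1|[f ->] i]; last first.
  apply/cards1P; exists (i, f i); apply/setP => -[a b]; rewrite !inE /= xpair_eqE.
  by rewrite andbC; case: eqP => [->|].
have e1' i : exists j, part e i == [set (i, j)].
  have /cards1P[[a b] eab] := e1 i; exists b.
  have : (a, b) \in part e i by rewrite eab inE.
  by rewrite inE => /andP[_ /eqP /= ai]; rewrite eab ai.
exists [ffun i => xchoose (e1' i)]; apply/setP => -[a b].
have /eqP := xchooseP (e1' a) => /setP/(_ (a, b)).
by rewrite !inE /= eqxx andbT ffunE => ->; rewrite xpair_eqE eqxx.
Qed.

Lemma subhypergraph_sub G X : subhypergraph G X \subset G.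
Proof. by apply/fintype.subsetP => e; rewrite inE => /andP[]. Qed.

Lemma card_edges_in X :
  #|subhypergraph (edges r n) X| = (\prod_(i < r) #|part X i|)%N.
Proof.
set F := fun i : 'I_r => [pred j : 'I_n | (i, j) \in X].
have -> : subhypergraph (edges r n) X = graph_edge @: family F.
  apply/setP => e; rewrite inE; apply/andP/imsetP.
    move=> [/graph_edgeP[f ->] /fintype.subsetP fX]; exists f => //.
    by apply/familyP => i; rewrite inE; apply: fX; rewrite inE.
  move=> [f /familyP fF ->]; split; first by apply/graph_edgeP; exists f.
  by apply/fintype.subsetP => -[a b]; rewrite inE /= => /eqP->; have := fF a; rewrite inE.
rewrite card_imset; last exact: graph_edge_inj.
rewrite card_family foldrE big_map big_enum /=; apply: eq_bigr => i _.
rewrite -(card_imset (F i) (f := pair i)); last by move=> ? ? [].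
apply: eq_card => -[a b]; rewrite !inE /=; apply/imsetP/andP.
  by move=> [j]; rewrite !inE => jX [-> ->].
by move=> [abX /eqP ai]; exists b; rewrite -ai ?inE.
Qed.

Lemma card_part_edge (e : {set vertex r n}) i : e \in edges r n -> #|part e i| = 1%N.
Proof. by rewrite inE => /forallP/(_ i)/eqP. Qed.

(* Double counting: every edge inside [Y] has exactly one vertex in the largest part. *)
Lemma min_degree_edges G Y k : (0 < r)%N -> G \subset edges r n ->
  (forall v, v \in Y -> (k <= degree (subhypergraph G Y) v)%N) ->
  (max_part Y * k <= #|subhypergraph G Y|)%N.
Proof.
move=> /(imaxP Y)[i0 <- _] /fintype.subsetP GE degY.
rewrite -sum_nat_const.
apply: (@leq_trans (\sum_(v in part Y i0) degree (subhypergraph G Y) v)%N).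
  by apply: leq_sum => v; rewrite inE => /andP[/degY].
under eq_bigr do rewrite /degree -sum1_card.
rewrite (exchange_big_dep (mem (subhypergraph G Y))) /=; last first.
  by move=> v e _; rewrite inE => /andP[].
rewrite -sum1_card; apply: leq_sum => e; rewrite inE => /andP[eG eY].
rewrite -[leqRHS](card_part_edge i0 (GE e eG)) -sum1_card eq_leq //.
apply: eq_bigl => v; rewrite !inE eG eY /=.
case: (boolP (v \in e)) => [ve|]; last by rewrite andbF.
by rewrite (fintype.subsetP eY v ve) andbT.
Qed.

End Counting.

(** * The product measure: moments, union bound, Markov inequality *)

Section Moments.
Variables (R : realType) (r n : nat).
Implicit Types (p z : R) (X : {set vertex r n}) (G F : hypergraph r n).
Implicit Types (A : pred (hypergraph r n)).

Lemma weight_ge0 p G : 0 <= p <= 1 -> 0 <= weight p G.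
Proof.
move=> /andP[p0 p1]; apply: prodr_ge0 => e _.
by case: ifP; rewrite ?subr_ge0.
Qed.

(** Expand a product of [a e + b e] over all vertex sets [e]; the values 0 and 1 off [edges r n]
    kill every [G] containing a non-edge. *)
Lemma weight_moment p z F : F \subset edges r n ->
  \sum_(G : hypergraph r n | G \subset edges r n) weight p G * z ^+ #|G :&: F|
  = (1 - p + p * z) ^+ #|F|.
Proof.
move=> /fintype.subsetP FE.
pose a e := if e \in edges r n then p * (if e \in F then z else 1) else 0.
pose b e := if e \in edges r n then 1 - p else 1.
have <- : \prod_e (a e + b e) = (1 - p + p * z) ^+ #|F|.
  rewrite -prodr_const [RHS]big_mkcond /=; apply: eq_bigr => e _.
  rewrite /a /b; case: (boolP (e \in F)) => [eF|_]; first by rewrite (FE e eF) addrC.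
  by case: ifP => _; rewrite ?add0r // mulr1 addrC subrK.
rewrite bigA_distr big_mkcond /=; apply: eq_bigr => G _; case: ifPn => [GE|].
  rewrite /weight -prodr_const big_mkcond [X in _ * X]big_mkcond -big_split /=.
  apply: eq_bigr => e _; rewrite finset.in_setI /a /b.
  case: (boolP (e \in G)) => [eG|_] /=; last by rewrite mulr1.
  by rewrite (fintype.subsetP GE).
move=> /fintype.subsetPn[e eG eE]; apply/esym/eqP/prodf_eq0; exists e => //.
by rewrite eG /a (negbTE eE).
Qed.

Lemma Pr_compl p A : Pr p A = 1 - Pr p (predC A).
Proof.
suff <- : Pr p A + Pr p (predC A) = 1 by rewrite addrK.
have := weight_moment p 1 (finset.sub0set (edges r n)); rewrite cards0 expr0 => <-.
rewrite [RHS](bigID A) /=.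
by congr (_ + _); apply: eq_bigr => G _; rewrite expr1n mulr1.
Qed.

Lemma Pr_le1 p A : 0 <= p <= 1 -> Pr p A <= 1.
Proof.
by move=> p01; rewrite Pr_compl lerBlDr lerDl sumr_ge0 // => G _; apply: weight_ge0.
Qed.

Lemma Pr_union p A (I : finType) (B : I -> pred (hypergraph r n)) :
  0 <= p <= 1 ->
  (forall G, G \subset edges r n -> A G -> exists i, B i G) ->
  Pr p A <= \sum_i Pr p (B i).
Proof.
move=> p01 AB; rewrite /Pr.
under [leRHS]eq_bigr do rewrite big_mkcondr /=.
rewrite exchange_big /= big_mkcondr /=; apply: ler_sum => G GE.
have w0 i : 0 <= (if B i G then weight p G else 0).
  by case: ifP => // _; apply: weight_ge0.
case: ifP => [AG|_]; last exact: sumr_ge0.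
have [i Bi] := AB G GE AG.
by rewrite (bigD1 i) //= Bi lerDl sumr_ge0.
Qed.

(** Markov's inequality for [z ^+ #|G :&: F|], with [1 + x <= exp x] on each factor. Taking [z = 0]
    handles the absence of edges, [z > 1] their abundance. *)
Lemma Pr_markov p z c A F : 0 <= p <= 1 -> 0 <= z -> F \subset edges r n ->
  (forall G, G \subset edges r n -> A G -> c <= z ^+ #|G :&: F|) ->
  Pr p A * c <= expR (p * (z - 1) * #|F|%:R).
Proof.
move=> /[dup] p01 /andP[p0 p1] z0 FE Ac.
apply: (@le_trans _ _ ((1 - p + p * z) ^+ #|F|)).
  rewrite -weight_moment // /Pr mulr_suml [leRHS](bigID A) /=.
  rewrite -[leLHS]addr0 lerD ?sumr_ge0 //.
    by apply: ler_sum => G /andP[GE AG]; rewrite ler_wpM2l ?weight_ge0 ?Ac.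
  by move=> G _; rewrite mulr_ge0 ?weight_ge0 ?exprn_ge0.
have ge0 : 0 <= 1 - p + p * z by rewrite addr_ge0 ?subr_ge0 ?mulr_ge0.
rewrite expRM_natr lerXn2r ?nnegrE ?expR_ge0 //.
by apply: le_trans (expR_ge1Dx _); rewrite mulrBr mulr1 addrA addrAC.
Qed.

Lemma Pr_gt0_ex p A : 0 < Pr p A ->
  exists2 G : hypergraph r n, G \subset edges r n & A G.
Proof.
move=> PA; have [/existsP[G /andP[GE AG]]|/existsPn nA] :=
  boolP [exists G : hypergraph r n, (G \subset edges r n) && A G].
  by exists G.
by move: PA; rewrite /Pr big_pred0 ?ltxx // => G; apply/negbTE/nA.
Qed.

End Moments.

(** * Summation over all vertex sets *)

Section UnionBound.
Variables (R : realType) (r n : nat).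
Hypothesis n_gt0 : (0 < n)%N.
Implicit Types (X : {set vertex r n}).

(** Partial sums of the series of [s / 2^(s-1)], whose total is 4. *)
Lemma sum_arith_geom m :
  \sum_(s < m) s%:R * 2^-1 ^+ s.-1 = 4 - 4 * m.+1%:R * 2^-1 ^+ m :> R.
Proof.
elim: m => [|m IHm]; first by rewrite big_ord0 expr0 !mulr1 subrr.
rewrite big_ord_recr /= IHm; case: m {IHm} => [|m] /=.
  by rewrite expr0 expr1; lra.
have e1 : m.+1%:R = m%:R + 1 :> R by rewrite -natr1.
have e2 : m.+2%:R = m%:R + 2 :> R by rewrite -addn2 natrD.
have e3 : m.+3%:R = m%:R + 3 :> R by rewrite -addn3 natrD.
by rewrite e1 e2 e3 !exprS; field.
Qed.

Lemma sum_expr_card (u : R) :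
  \sum_(X : {set vertex r n}) u ^+ #|X| = (1 + u) ^+ (r * n).
Proof.
have -> : (1 + u) ^+ (r * n) = \prod_(v : vertex r n) (u + 1).
  by rewrite prodr_const card_prod !card_ord addrC.
rewrite bigA_distr; apply: eq_bigr => X _.
by rewrite -prodr_const big_mkcond.
Qed.

Definition max_density X : R := (max_part X)%:R / n%:R.

Lemma max_density_le1 X : max_density X <= 1.
Proof. by rewrite ler_pdivrMr ?ltr0n // mul1r ler_nat max_part_le. Qed.

(* At most [(e / u)^(r s)] sets have largest part of size [s = u n]; this is read off
   the generating function [(1 + u)^(r n)] of the sizes of all sets. *)
Lemma sum_max_density s :
  \sum_(X : {set vertex r n} | max_part X == s) ((max_density X / expR 1) ^+ r) ^+ s <= 1.
Proof.
set u : R := s%:R / n%:R.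
have u0 : 0 <= u by rewrite divr_ge0.
have [un|un] := ltP 1 u.
  rewrite big_pred0 // => X; apply/negP => /eqP sX.
  by have := max_density_le1 X; rewrite /max_density sX leNgt un.
(* Since [u <= 1] and [#|X| <= r s], [u^(r s) <= u^#|X|]. The sum may then run over all sets, and
   [(1 + u)^(r n) <= exp (u r n) = exp (r s)]. *)
apply: (@le_trans _ _ (\sum_(X : {set vertex r n}) u ^+ #|X| * expR (- (r * s)%:R))); last first.
  rewrite -mulr_suml sum_expr_card expRN ler_pdivrMr ?expR_gt0 // mul1r.
  have -> : expR (r * s)%:R = expR u ^+ (r * n).
    rewrite -expRM_natl; congr expR; rewrite /u !natrM.
    by field; rewrite pnatr_eq0 -lt0n.
  by rewrite lerXn2r ?nnegrE ?expR_ge0 ?addr_ge0 // expR_ge1Dx.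
rewrite [leRHS](bigID (fun X => max_part X == s)) /= -[leLHS]addr0 lerD //; last first.
  by apply: sumr_ge0 => X _; rewrite mulr_ge0 ?exprn_ge0 ?expR_ge0.
apply: ler_sum => X /eqP sX; rewrite -exprM exprMn exprVn -expRM_natl mulr1.
rewrite /max_density sX -/u expRN ler_wpM2r ?invr_ge0 ?expR_ge0 //.
by rewrite ler_wiXn2l // -sX card_le_max_part.
Qed.

(** One factor [b] pays for [s / n], the other [s - 1] for powers of [1/2]. Assuming [0 < f X] lets
    a bad event be taken as possible when its set is bounded. *)
Lemma union_sum (f : {set vertex r n} -> R) :
  (forall X, 0 < f X -> (0 < max_part X)%N /\
     exists b : R, [/\ 0 <= b, b <= 2^-1, b <= max_density X &
       f X <= (b * (max_density X / expR 1) ^+ r) ^+ max_part X]) ->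
  \sum_(X : {set vertex r n}) f X <= 4 / n%:R.
Proof.
move=> fX; have n0 : 0 < n%:R :> R by rewrite ltr0n.
pose g s : R := s%:R / n%:R * 2^-1 ^+ s.-1.
have md0 X : 0 <= max_density X by rewrite divr_ge0.
have g0 s : 0 <= g s by rewrite !mulr_ge0 ?exprn_ge0 ?invr_ge0.
apply: (@le_trans _ _
  (\sum_(X : {set vertex r n}) g (max_part X) * ((max_density X / expR 1) ^+ r) ^+ max_part X)).
  apply: ler_sum => X _; have [f0|/fX] := leP (f X) 0.
    by apply: le_trans f0 _; rewrite mulr_ge0 ?exprn_ge0 ?divr_ge0 ?expR_ge0.
  move=> [m0 [b [b0 b2 bu fb]]]; apply: le_trans fb _.
  rewrite exprMn ler_wpM2r ?exprn_ge0 ?divr_ge0 ?expR_ge0 // /g.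
  rewrite -[in leLHS](prednK m0) exprS.
  by rewrite ler_pM ?exprn_ge0 // lerXn2r ?nnegrE ?invr_ge0.
rewrite (partition_big (fun X => inord (max_part X) : 'I_n.+1) predT) //=.
apply: (@le_trans _ _ (\sum_(s < n.+1) g s)).
  apply: ler_sum => s _; rewrite -[leRHS]mulr1.
  apply: le_trans (ler_wpM2l (g0 s) (sum_max_density s)).
  rewrite mulr_sumr le_eqVlt; apply/orP; left; apply/eqP.
  apply: eq_big => [X|X /eqP/(congr1 val)].
    by rewrite -val_eqE /= inordK // ltnS max_part_le.
  by rewrite /= inordK ?ltnS ?max_part_le // => ->.
under eq_bigr do rewrite /g mulrAC.
rewrite -mulr_suml ler_wpM2r ?invr_ge0 ?ler0n //.
by rewrite sum_arith_geom gerBl !mulr_ge0 ?exprn_ge0 ?invr_ge0.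
Qed.

End UnionBound.

(** * Real inequalities for a single vertex set *)

Section Estimates.
Variable R : realType.
Implicit Types (u w L : R).

(** As [r >= 2], [u^(r-1) <= u], whence [u^r = u * u^(r-1) >= w^2]. This bounds the counting factor
    [(e / u)^r] by [e^r / w^2]. *)
Lemma density_bounds r u w : (2 <= r)%N -> 0 < u <= 1 -> 0 < w -> w <= u ^+ r.-1 ->
  w <= u /\ (u ^+ r)^-1 <= (w ^+ 2)^-1.
Proof.
case: r => [|[|r]] // _ /andP[u0 u1] w0 /= wu.
have wleu : w <= u.
  by apply: le_trans wu _; rewrite exprS ler_piMr ?exprn_ile1 // ltW.
split=> //; rewrite lef_pV2 ?posrE ?exprn_gt0 //.
by rewrite expr2 exprS ler_pM // ltW.
Qed.

(** The last identity forces [b]. With [w = exp (-L)], [b <= exp (r + 2 L - L^2) <= exp (-L)],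
    because [L^2 >= 4 L >= 3 L + r]. *)
Lemma independent_estimate r u L : (2 <= r)%N -> 0 < u <= 1 -> 4 <= L -> r%:R <= L ->
  expR (- L) <= u ^+ r.-1 ->
  exists b : R, [/\ 0 <= b, b <= 2^-1, b <= u &
    expR (- L ^+ 2) = b * (u / expR 1) ^+ r].
Proof.
move=> r2 /[dup] u01 /andP[u0 u1] L4 Lr Lu.
have [wu uw] := density_bounds r2 u01 (expR_gt0 _) Lu.
exists (expR (- L ^+ 2) * (expR 1 / u) ^+ r).
have bw : expR (- L ^+ 2) * (expR 1 / u) ^+ r <= expR (- L).
  rewrite exprMn exprVn -expRM_natl mulr1 mulrA.
  apply: le_trans (ler_wpM2l _ uw) _; first by rewrite mulr_ge0 ?expR_ge0.
  rewrite -expRM_natl -expRN -!expRD ler_expR.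
  by nra.
have w2 : expR (- L) <= 2^-1.
  rewrite expRN lef_pV2 ?posrE ?expR_gt0 //.
  by apply: le_trans (expR_ge1Dx L); lra.
split.
- by rewrite mulr_ge0 ?exprn_ge0 ?divr_ge0 ?expR_ge0 // ltW.
- exact: le_trans bw w2.
- exact: le_trans bw wu.
- rewrite -mulrA -exprMn mulrA divfK ?gt_eqF // divff ?gt_eqF ?expR_gt0 //.
  by rewrite expr1n mulr1.
Qed.

(** Here [y] stands for [p Q] and [w = exp (-L) * y]; showing [b <= w] yields both [b <= 1/2] and
    [b <= u]. *)
Lemma degenerate_estimate r u y L (k : nat) : (2 <= r)%N -> 0 < u <= 1 -> 0 < y <= 1 ->
  1 <= L -> 2 * r%:R <= L -> 0 < ln L -> ln (ln L) + 1 <= ln L / 8 ->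
  4 * L / ln L <= k%:R ->
  expR (- L) * y <= u ^+ r.-1 ->
  exists b : R, [/\ 0 <= b, b <= 2^-1, b <= u &
    (expR 1 * y / k%:R) ^+ k = b * (u / expR 1) ^+ r].
Proof.
move=> r2 /[dup] u01 /andP[u0 u1] /andP[y0 y1] L1 Lr l0 ll Lk Lu.
have L0 : 0 < L by lra.
have lnL : ln L <= L by rewrite -ler_expR lnK ?posrE // (le_trans _ (expR_ge1Dx L)) //; lra.
have q0 : 0 < 4 * L / ln L by rewrite divr_gt0 // mulr_gt0.
have k0 : 0 < k%:R :> R by apply: lt_le_trans Lk.
have k4 : (4 <= k)%N.
  rewrite -(ler_nat R); apply: le_trans Lk.
  by rewrite -mulrA ler_peMr // ler_pdivlMr // mul1r.
have [wu uw] := density_bounds r2 u01 (mulr_gt0 (expR_gt0 _) y0) Lu.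
have lnk : 1 - ln k%:R <= - (7 / 8 * ln L).
  have : ln (4 * L / ln L) <= ln k%:R by rewrite ler_ln ?posrE.
  rewrite ln_div ?posrE ?mulr_gt0 // lnM ?posrE //.
  have : 0 <= ln 4 :> R by rewrite ln_ge0 //; lra.
  by lra.
(* The constant is [4 * 7/8], from [k >= 4 L / ln L] and [ln k - 1 >= 7/8 ln L]. *)
have ek : (expR 1 / k%:R) ^+ k <= expR (- (7 / 2 * L)) :> R.
  rewrite -[X in expR 1 / X](lnK (x := k%:R)) ?posrE // -expRN -expRD -expRM_natl ler_expR.
  have : k%:R * (1 - ln k%:R) <= k%:R * - (7 / 8 * ln L) by rewrite ler_wpM2l // ltW.
  move: Lk; rewrite ler_pdivrMr //; nra.
pose b := (expR 1 * y / k%:R) ^+ k * (expR 1 / u) ^+ r.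
exists b; have bw : b <= expR (- L) * y.
  rewrite /b mulrAC (mulrC _ y) exprMn [X in _ * X]exprMn exprVn.
  rewrite -[X in _ * (X * _)]expRM_natl mulr1.
  apply: (@le_trans _ _ (y ^+ k * (expR 1 / k%:R) ^+ k *
    (expR r%:R * ((expR (- L) * y) ^+ 2)^-1))).
    rewrite !ler_wpM2l ?expR_ge0 // mulr_ge0 ?exprn_ge0 ?divr_ge0 ?expR_ge0 //.
    exact: ltW.
  (* Of the three factors [y] kept, two cancel those in [w^2] and the third survives in the target
     [w]. *)
  apply: (@le_trans _ _ (y ^+ 3 * expR (- (7 / 2 * L)) *
    (expR r%:R * ((expR (- L) * y) ^+ 2)^-1))).
    rewrite ler_wpM2r ?mulr_ge0 ?invr_ge0 ?exprn_ge0 ?mulr_ge0 ?expR_ge0 ?(ltW y0) //.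
    rewrite ler_pM ?exprn_ge0 ?divr_ge0 ?expR_ge0 ?(ltW y0) //.
    by rewrite ler_wiXn2l ?(ltW y0) // ltnW.
  have -> : y ^+ 3 * expR (- (7 / 2 * L)) * (expR r%:R * ((expR (- L) * y) ^+ 2)^-1) =
      expR (r%:R - 3 / 2 * L) * y.
    have -> : r%:R - 3 / 2 * L = - (7 / 2 * L) + (r%:R + (L + L)) by field.
    rewrite expRN !expRD expRN; field.
    by rewrite !gt_eqF ?expR_gt0.
  rewrite ler_wpM2r ?(ltW y0) // ler_expR; lra.
have w2 : expR (- L) <= 2^-1.
  rewrite expRN lef_pV2 ?posrE ?expR_gt0 //.
  by apply: le_trans (expR_ge1Dx L); lra.
split.
- by rewrite /b mulr_ge0 ?exprn_ge0 ?divr_ge0 ?mulr_ge0 ?expR_ge0 // ltW.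
- by apply: le_trans bw (le_trans _ w2); rewrite ler_piMr ?expR_ge0.
- exact: le_trans bw wu.
- rewrite /b -[RHS]mulrA -[X in _ = _ * X]exprMn -[u / expR 1]invf_div.
  by rewrite mulfV ?expr1n ?mulr1 // mulf_neq0 ?invr_eq0 ?gt_eqF ?expR_gt0.
Qed.

End Estimates.

(** * Failure probabilities of the two properties *)

Section Properties.
Variables (R : realType) (r n : nat) (p d L : R).
Hypotheses (r2 : (2 <= r)%N) (n_gt0 : (0 < n)%N) (p01 : 0 <= p <= 1).
Hypotheses (dE : d = p * n%:R ^+ r.-1) (LK : expR L = d).
Hypotheses (L4 : 4 <= L) (Lr : 2 * r%:R <= L).
Hypothesis ll : ln (ln L) + 1 <= ln L / 8.
Implicit Types (X Y : {set vertex r n}) (G : hypergraph r n).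

Let r_gt0 : (0 < r)%N. Proof. exact: ltnW. Qed.
Let n0 : 0 < n%:R :> R. Proof. by rewrite ltr0n. Qed.
Let L0 : 0 < L. Proof. exact: lt_le_trans L4. Qed.
Let nX0 : 0 < n%:R ^+ r.-1 :> R. Proof. by rewrite exprn_gt0. Qed.
Let Ld : ln d = L. Proof. by rewrite -LK expRK. Qed.
Let d0 : 0 < d. Proof. by rewrite -LK expR_gt0. Qed.
Let p0 : 0 < p. Proof. by rewrite -(pmulr_lgt0 _ nX0) -dE. Qed.
(** Both thresholds thus become conditions on [p Q], the expected number of edges inside the set at
    a vertex of its largest part. *)
Let densityE : n%:R ^+ r.-1 / d = p^-1.
Proof. by rewrite dE invfM mulrCA mulfV ?gt_eqF // mulr1. Qed.

Let prod_others_density X : p * (prod_others X)%:R <= d * max_density R X ^+ r.-1.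
Proof.
rewrite dE /max_density expr_div_n -mulrA ler_wpM2l ?(ltW p0) //.
by rewrite mulrCA mulfV ?gt_eqF // mulr1 -natrX ler_nat prod_others_le.
Qed.

Let max_density_gt0 X : (0 < max_part X)%N -> 0 < max_density R X <= 1.
Proof. by move=> m0; rewrite max_density_le1 // divr_gt0 ?ltr0n. Qed.

Lemma Pr_not_propI : Pr p (predC (fun G : hypergraph r n => propI d G)) <= 4 / n%:R.
Proof.
pose B X G := independent G X && (n%:R ^+ r.-1 / d * L ^+ 2 <= (prod_others X)%:R).
apply: (@le_trans _ _ (\sum_(X : {set vertex r n}) Pr p (B X))).
  apply: Pr_union => // G _ /= /forallPn[X]; rewrite Ld negb_imply -leNgt => BX.
  by exists X.
apply: union_sum => // X BX0.
have [G _ /andP[_]] := Pr_gt0_ex BX0; rewrite densityE ler_pdivrMl // => pP.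
have P0 : (0 < prod_others X)%N.
  by rewrite lt0n; apply: contraTneq pP => ->; rewrite mulr0 -ltNge exprn_gt0.
have m0 : (0 < max_part X)%N.
  rewrite lt0n; apply: contraTneq P0 => m0; rewrite -leqNgt.
  have := prod_others_le X r_gt0; rewrite m0 exp0n //.
  by rewrite -ltnS prednK.
split=> //.
have [||b [b0 b2 bu bE]] := independent_estimate r2 (max_density_gt0 m0) L4 _ _.
- by apply: le_trans Lr; rewrite ler_peMl // ler1n.
(* Here [1 <= L^2 <= p Q <= d u^(r-1)]. *)
- rewrite expRN LK -[leLHS]mulr1 ler_pdivrMl //.
  apply: le_trans (le_trans pP (prod_others_density X)).
  by rewrite exprn_ege1 // (le_trans _ L4) // ler1n.
exists b; split=> //; rewrite -bE -expRM_natr.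
rewrite -[leLHS]mulr1.
have FE := subhypergraph_sub (edges r n) X.
(* With [z = 0], independence gives the moment the value [0 ^+ 0 = 1], so [c = 1]. *)
apply: le_trans (Pr_markov p01 (lexx 0) FE _) _.
  move=> G' G'E /andP[/forallP indep _].
  suff -> : G' :&: subhypergraph (edges r n) X = finset.set0 by rewrite cards0.
  apply/setP => e; rewrite !inE; apply/negP => /and3P[eG _ eX].
  by have := indep e; rewrite eG eX.
rewrite card_edges_in prod_partsE // ler_expR sub0r mulrN1 !mulNr lerN2 natrM.
by rewrite mulrC [leRHS]mulrCA ler_wpM2l.
Qed.

Lemma Pr_not_propD : Pr p (predC (fun G : hypergraph r n => propD d G)) <= 4 / n%:R.
Proof.
(* A degree exceeds the real threshold exactly when it exceeds [k], that is, when it is at least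
   [k.+1]. *)
set k := Num.truncn (4 * L / ln L).
have lnL0 : 0 < ln L by rewrite ln_gt0 // (lt_le_trans _ L4) // ltr1n.
have q0 : 0 <= 4 * L / ln L by rewrite divr_ge0 ?mulr_ge0 // ltW.
pose B Y G := [&& Y != finset.set0, (prod_others Y)%:R < p^-1 &
  [forall v in Y, (k < degree (subhypergraph G Y) v)%N]].
apply: (@le_trans _ _ (\sum_(Y : {set vertex r n}) Pr p (B Y))).
  apply: Pr_union => // G _ /= /forallPn[X]; rewrite Ld negb_imply densityE.
  move=> /andP[PX /forallPn[Y]]; rewrite negb_imply => /andP[/andP[YX Y0] degY].
  exists Y; apply/and3P; split=> //.
    by apply: le_lt_trans PX; rewrite ler_nat prod_others_mono.
  apply/forallP => v; apply/implyP => vY; move: degY => /existsPn/(_ v).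
  by rewrite vY /= -ltNge truncn_lt_nat.
apply: union_sum => // Y BY0.
have edgesY G : G \subset edges r n -> B Y G ->
    (max_part Y * k.+1 <= #|G :&: subhypergraph (edges r n) Y|)%N.
  move=> GE /and3P[_ _ /forallP degY].
  have -> : G :&: subhypergraph (edges r n) Y = subhypergraph G Y.
    apply/setP => e; rewrite !finset.inE; case: (boolP (e \in G)) => //= eG.
    by have /fintype.subsetP/(_ e eG) := GE; rewrite finset.inE => ->.
  by apply: min_degree_edges => // v vY; have := degY v; rewrite vY.
have [G GE BG] := Pr_gt0_ex BY0.
have /and3P[Yn0 PY _] := BG.
have m0 : (0 < max_part Y)%N.
  have : (0 < #|Y|)%N by rewrite card_gt0.
  by move/leq_trans/(_ (card_le_max_part Y)); rewrite muln_gt0 => /andP[].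
have P0 : (0 < prod_others Y)%N.
  have : (0 < max_part Y * k.+1)%N by rewrite muln_gt0 m0.
  move/leq_trans/(_ (edgesY G GE BG)).
  move/leq_trans/(_ (subset_leq_card (finset.subsetIr _ _))).
  by rewrite card_edges_in prod_partsE // muln_gt0 => /andP[].
split=> //; set y := p * (prod_others Y)%:R.
have y0 : 0 < y by rewrite mulr_gt0 ?ltr0n.
have y1 : y < 1 by rewrite /y mulrC -ltr_pdivlMr // mul1r.
have Lk : 4 * L / ln L <= k.+1%:R by rewrite ltW // truncnS_gt.
have y01 : 0 < y <= 1 by rewrite y0 ltW.
have L1 : 1 <= L by rewrite (le_trans _ L4) // ler1n.
have [|b [b0 b2 bu bE]] :=
    degenerate_estimate r2 (max_density_gt0 m0) y01 L1 Lr lnL0 ll Lk.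
  by rewrite expRN LK ler_pdivrMl // prod_others_density.
exists b; split=> //; rewrite -bE -exprM.
(* With mean [s y] and target [s k.+1], the exponential bound is minimal at [z = k.+1 / y]. As
   [y < 1], this [z] exceeds 1, so a lower bound on the number of edges suffices. *)
have z0 : 0 < k.+1%:R / y by rewrite divr_gt0.
have FE := subhypergraph_sub (edges r n) Y.
have := Pr_markov (c := (k.+1%:R / y) ^+ (max_part Y * k.+1)) p01 (ltW z0) FE.
move=> /(_ (B Y)); rewrite -ler_pdivlMr ?exprn_gt0 // => H.
apply: le_trans (H _) _.
  move=> G' G'E BG'; rewrite ler_weXn2l ?edgesY //.
  by rewrite ler_pdivlMr // mul1r (le_trans (ltW y1)) // ler1n.
rewrite card_edges_in prod_partsE // [(_ * k.+1)%N]mulnC -exprVn invf_div.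
rewrite -[expR 1 * y / _]mulrA [leRHS]exprMn ler_wpM2r ?exprn_ge0 ?divr_ge0 ?(ltW y0) //.
rewrite -expRM_natr mul1r ler_expR !natrM.
have -> : p * (k.+1%:R / y - 1) * ((max_part Y)%:R * (prod_others Y)%:R) =
    (k.+1%:R - y) * (max_part Y)%:R.
  by rewrite /y; field; rewrite !gt_eqF ?ltr0n.
by rewrite ler_wpM2r // gerBl ltW.
Qed.

Lemma Pr_propID : 1 - 8 / n%:R <= Pr p (fun G : hypergraph r n => propI d G && propD d G).
Proof.
rewrite Pr_compl lerD2l lerN2.
pose B (b : bool) (G : hypergraph r n) := if b then ~~ propI d G else ~~ propD d G.
apply: (@le_trans _ _ (\sum_b Pr p (B b))).
  apply: Pr_union => // G _ /=; rewrite negb_and => /orP[HI|HD].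
    by exists true.
  by exists false.
have -> : 8 / n%:R = 4 / n%:R + 4 / n%:R :> R by rewrite -mulrDl -natrD.
by rewrite big_bool /=; exact: lerD Pr_not_propI Pr_not_propD.
Qed.

End Properties.

(** * The choice of [d0] and the limit *)

Local Open Scope classical_set_scope.

Theorem theorem1p3 (R : realType) (r : nat) (hr : (2 <= r)%N) :
  exists d0 : R, forall p : nat -> R,
    (forall n : nat, 0 <= p n <= 1) ->
    (\forall n \near \oo, d0 <= p n * n%:R ^+ r.-1) ->
    (fun n : nat =>
       Pr (p n) (fun G : hypergraph r n =>
         propI (p n * n%:R ^+ r.-1) G && propD (p n * n%:R ^+ r.-1) G))
      @ \oo --> (1 : R).
Proof.
(* [l0] makes [ln l + 1 <= l / 8] for [l >= l0], by [ln (l / 16) <= l / 16 - 1]. *)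
have ln16 : 0 <= ln 16 :> R by rewrite ln_ge0 //; lra.
pose l0 : R := 16 * ln 16 + 16.
(* With [L = ln d], the three summands give [ln L >= l0], [L >= 2 r] and [L >= 4]. *)
exists (expR (expR l0 + 2 * r%:R + 4)) => p p01 d_ge.
(* [harmonic n] is [1 / (n + 1)], and [16 / (n + 1) >= 8 / n] once [n >= 1]. *)
apply: (@squeeze_cvgr _ _ _ _ (fun n => 1 - 16 * harmonic n) (fun=> 1)); last 2 first.
- rewrite -[X in _ --> X]subr0 -[X in _ --> _ - X](mulr0 16).
  by apply: cvgB; [exact: cvg_cst|apply: cvgMl_tmp; exact: cvg_harmonic].
- exact: cvg_cst.
near=> n; rewrite Pr_le1 // andbT.
have n0 : (0 < n)%N by near: n; exact: nbhs_infty_gt.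
apply: (@le_trans _ _ (1 - 8 / n%:R)).
  rewrite lerD2l lerN2 /harmonic ler_pdivrMr ?ltr0n // mulrAC ler_pdivlMr ?ltr0n //.
  have : 1 <= n%:R :> R by rewrite ler1n.
  by rewrite -[n.+1%:R]natr1; lra.
have dn : expR (expR l0 + 2 * r%:R + 4) <= p n * n%:R ^+ r.-1.
  by near: n.
have d0 := lt_le_trans (expR_gt0 _) dn.
have Ln : expR l0 + 2 * r%:R + 4 <= ln (p n * n%:R ^+ r.-1).
  by rewrite -ler_expR lnK ?posrE.
have r0 : 0 <= r%:R :> R by [].
have e0 : 0 < expR l0 by exact: expR_gt0.
apply: (Pr_propID hr _ (p01 n) erefl (lnK _)); [by []|by []|lra|lra|].
set L := ln _ in Ln *.
have L0 : 0 < L by lra.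
have l_ge : l0 <= ln L by rewrite -ler_expR lnK ?posrE //; lra.
have l_gt0 : 0 < ln L by rewrite (lt_le_trans _ l_ge) // /l0; lra.
have : ln (ln L / 16) <= ln L / 16 - 1.
  rewrite -ler_expR lnK ?posrE ?divr_gt0 //.
  by apply: le_trans (expR_ge1Dx _); lra.
rewrite ln_div ?posrE //.
by move: l_ge; rewrite /l0; lra.
Unshelve. all: by end_near.
Qed.
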